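(* Let $K$ be an infinite field and $S=K[x_1,\ldots,x_n]$. If $I$ is a stably lexsegment ideal of $S$, then the $k$-th symbolic power $I^{(k)}$ is lexsegment for each positive integer $k$.
   Context: A monomial ideal $I$ of $S=K[x_1,\ldots,x_n]$ is lexsegment if for all monomials $u\in I$ and $v\in S$ with $\deg v=\deg u$ and $v>_{lex}u$ (lexicographic order with $x_1>\cdots>x_n$), one has $v\in I$. A monomial ideal $I$ is called stably lexsegment if $I^k$ is lexsegment for each $k>0$. $\mathrm{Min}(I)$ denotes the set of prime ideals minimal over $I$, and the $k$-th symbolic power of $I$ is $I^{(k)}=\bigcap_{P\in \mathrm{Min}(I)}\ker\big(S\to (S/I^k)_P\big)$. *)

(* Defs.v *)
From mathcomp Require Export all_boot all_order all_algebra.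
From mathcomp Require Export boolp classical_sets functions cardinality.
From mathcomp Require Export mpoly.

Set Implicit Arguments.
Unset Strict Implicit.
Unset Printing Implicit Defensive.

Import Order.TTheory GRing.Theory.

Local Open Scope classical_set_scope.
Local Open Scope ring_scope.

(* The structures of ring_quotient only cover proper, decidable ideals; here  *)
(* the unit ideal must be allowed, so ideals are classical sets.              *)
Section Ideals.
Variable R : comNzRingType.
Implicit Types (I J P Q : set R) (f : R).

Definition is_ideal I :=
  [/\ I 0, forall f g, I f -> I g -> I (f + g) & forall a f, I f -> I (a * f)].

Definition ideal_gen (A : set R) : set R := smallest is_ideal A.

Definition ideal_mul I J : set R :=
  ideal_gen [set h | exists f g, [/\ I f, J g & h = f * g]].

Fixpoint ideal_pow I (k : nat) : set R :=
  if k is k'.+1 then ideal_mul I (ideal_pow I k') else setT.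

Definition prime_ideal P :=
  [/\ is_ideal P, ~ P 1 & forall f g, P (f * g) -> P f \/ P g].

Definition minimal_primes I : set (set R) :=
  [set P | [/\ prime_ideal P, I `<=` P
             & forall Q, prime_ideal Q -> I `<=` Q -> Q `<=` P -> Q = P]].

(* The class of f in R / J. *)
Definition coset J f : set R := [set g | J (g - f)].

(* A pair x stands for the fraction x.1 / x.2 with numerator the class of x.1 *)
(* in R / J; equality of fractions is that of the localized module (R / J)_P. *)
Definition frac_eq J P (x y : R * R) :=
  exists2 u, ~ P u & coset J (u * (y.2 * x.1)) = coset J (u * (x.2 * y.1)).

(* The element of (R / J)_P represented by x, as an equivalence class. *)
Definition frac J P (x : R * R) : set (R * R) :=
  [set y | ~ P y.2 /\ frac_eq J P x y].

Definition loc_map J P f : set (R * R) := frac J P (f, 1).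

Definition loc_ker J P : set R := [set f | loc_map J P f = loc_map J P 0].

Definition symbolic_power I (k : nat) : set R :=
  \bigcap_(P in minimal_primes I) loc_ker (ideal_pow I k) P.

End Ideals.

Section Lexsegment.
Variables (K : fieldType) (n : nat).
Implicit Types (I : set {mpoly K[n]}) (u v : 'X_{1..n}).

Definition monomial_ideal I :=
  exists A : set 'X_{1..n}, I = ideal_gen [set 'X_[K, m] | m in A].

(* The order declared on 'X_{1..n} in mpoly is degree-based and not           *)
(* lexicographic; this is the lexicographic order on exponent tuples, in      *)
(* which the variable of index 0 is the largest.                              *)
Definition lex_lt u v :=
  (multinom_val u < multinom_val v :> n.-tuplelexi nat)%O.

Definition lexsegment I :=
  monomial_ideal I /\
  forall u v, I 'X_[u] -> mdeg v = mdeg u -> lex_lt u v -> I 'X_[v].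

Definition stably_lexsegment I :=
  monomial_ideal I /\ forall k, (0 < k)%N -> lexsegment (ideal_pow I k).

End Lexsegment.

(* Main.v *)
(* Let r be least such that I is contained in (x_0, ..., x_(r-1)).  Then I    *)
(* has a monomial in x_(r-1), ..., x_(n-1) only, so, being lexsegment, it     *)
(* contains a power of each x_j with j < r; hence every prime containing I    *)
(* contains (x_0, ..., x_(r-1)), the only possible minimal prime P.           *)
(* The lex-smallest monomial is multiplicative, and s is outside P iff its    *)
(* lex-smallest monomial is.  So if s f lies in the monomial ideal I^k with s *)
(* outside P, then so does t m, where t and m are the lex-smallest monomials  *)
(* of s and f.  Therefore ker (S -> (S / I^k)_P) is spanned by the monomials  *)
(* m such that t m is in I^k for some monomial t outside P, and it inherits   *)
(* the lexsegment property of I^k because lex is translation-invariant.       *)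

Require Import Defs.
From mathcomp Require Import ring.

Set Implicit Arguments.
Unset Strict Implicit.
Unset Printing Implicit Defensive.

Import Order.TTheory GRing.Theory.

Local Open Scope classical_set_scope.
Local Open Scope ring_scope.

(** A symbolic power is an intersection of localization kernels, and [lexsegment_bigcap] reduces the
    claim to each kernel. By [minimal_prime_lexsegment] the only primes involved are generated by
    initial variables. For such a prime, [lex_min_mul] replaces a multiplier s outside it by a
    monomial, so [loc_ker_var_ideal] describes the kernel by its monomials, and [lexsegment_loc_ker]
    reads the lexsegment property off that description. *)

Section Ideals.
Variable R : comNzRingType.
Implicit Types (I J P A : set R) (f g : R).

Lemma ideal_gen_is_ideal A : is_ideal (ideal_gen A).
Proof.
split=> [J [[] //]|f g Af Ag J JA|a f Af J JA].
  by case: (JA) => -[_ JD _] _; apply: JD; [apply: Af | apply: Ag].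
by case: (JA) => -[_ _ JM] _; apply: JM; apply: Af.
Qed.

Lemma ideal_sum J (T : Type) (r : seq T) (Q : pred T) (F : T -> R) :
  is_ideal J -> (forall i, Q i -> J (F i)) -> J (\sum_(i <- r | Q i) F i).
Proof. by case=> J0 JD JM FJ; apply: big_ind. Qed.

Lemma idealN J f : is_ideal J -> J f -> J (- f).
Proof. by case=> _ _ JM Jf; rewrite -mulN1r; apply: JM. Qed.

Lemma idealB J f g : is_ideal J -> J f -> J g -> J (f - g).
Proof.
by move=> idJ Jf Jg; case: (idJ) => _ JD _; apply: JD => //; apply: idealN.
Qed.

(** The recursion ends at the whole ring, so the first power is the product of I with R. This
    recovers I itself from the hypothesis on its powers. *)
Lemma ideal_pow1 I : is_ideal I -> ideal_pow I 1 = I.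
Proof.
move=> idI; case: (idI) => _ _ IM; apply/seteqP; split=> f /=; last first.
  by move=> If; apply: sub_gen_smallest; exists f, 1; rewrite mulr1.
move/(_ I); apply; split=> // h [g [a [Ig _ ->]]].
by rewrite mulrC; apply: IM.
Qed.

Lemma coset_eq J f g : is_ideal J -> coset J f = coset J g <-> J (f - g).
Proof.
move=> idJ; case: (idJ) => J0 JD _; split=> [fg|Jfg].
  suff: coset J g f by [].
  by rewrite -fg /coset /= subrr.
apply/seteqP; split=> h; rewrite /coset /= => Jh.
  by rewrite -(subrK f h) -addrA; apply: JD.
by rewrite -(subrK g h) -addrA; apply: JD => //; rewrite -opprB; apply: idealN.
Qed.

(** If u witnesses f/1 = a/b, then s * u witnesses g/1 = a/b, and it stays outside P by
    primality. *)
Lemma loc_map_sub J P f g s : is_ideal J -> prime_ideal P -> ~ P s ->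
  J (s * (f - g)) -> loc_map J P f `<=` loc_map J P g.
Proof.
move=> idJ [_ _ PM] Ps Js [a b] [/= Pb [u Pu /=]]; case: (idJ) => _ _ JM.
rewrite coset_eq // => Ju; split=> //; exists (s * u); first by case/PM.
rewrite coset_eq //=.
have -> : s * u * (b * g) - s * u * (1 * a) =
    s * (u * (b * f) - u * (1 * a)) - u * b * (s * (f - g)) by ring.
by apply: idealB => //; apply: JM.
Qed.

Lemma loc_kerP J P f : is_ideal J -> prime_ideal P ->
  loc_ker J P f <-> exists2 s, ~ P s & J (s * f).
Proof.
move=> idJ prP; case: (prP) => _ P1 _; split=> [kerf|[s Ps Jsf]].
  (* The class of 0 contains 0/1; reading this membership in the equal class of f yields the
     multiplier. *)
  have: loc_map J P 0 (0, 1) by split=> //; exists 1.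
  rewrite -kerf => -[_ [s Ps]] /=.
  by rewrite coset_eq // mul1r !mulr0 subr0; exists s.
by apply/seteqP; split; apply: (@loc_map_sub _ _ _ _ s) => //;
  rewrite ?subr0 // sub0r mulrN; apply: idealN.
Qed.

Lemma loc_ker_is_ideal J P : is_ideal J -> prime_ideal P ->
  is_ideal (loc_ker J P).
Proof.
move=> idJ prP; case: (idJ) (prP) => J0 JD JM [_ _ PM].
split=> [//|f g|a f]; rewrite !loc_kerP //.
  move=> [s Ps Jsf] [t Pt Jtg]; exists (s * t); first by case/PM.
  have -> : s * t * (f + g) = t * (s * f) + s * (t * g) by ring.
  by apply: JD; apply: JM.
by move=> [s Ps Jsf]; exists s; rewrite // mulrCA; apply: JM.
Qed.

End Ideals.

(** * The lexicographic order on monomials *)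

Section LexOrder.
Variable n : nat.
Implicit Types (u v w : 'X_{1..n}) (s : seq 'X_{1..n}).

Local Notation lex_le u v :=
  (multinom_val u <= multinom_val v :> n.-tuplelexi nat)%O.

Lemma lex_ltP u v :
  reflect (exists2 k : 'I_n, forall i : 'I_n, (i < k)%N -> u i = v i
                           & (u k < v k)%N)
          (lex_lt u v).
Proof.
by apply: (iffP ltxi_tuplePlt) => -[k eq_uv lt_uv]; exists k.
Qed.

Lemma lex_lt_add2l w u v : lex_lt u v -> lex_lt (w + u)%MM (w + v)%MM.
Proof.
move=> /lex_ltP[k eq_uv lt_uv]; apply/lex_ltP; exists k => [i /eq_uv eq_i|].
  by rewrite !mnmDE eq_i.
by rewrite !mnmDE ltn_add2l.
Qed.

Lemma lex_min_exists s : s != [::] ->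
  exists2 u, u \in s & forall v, v \in s -> v != u -> lex_lt u v.
Proof.
elim: s => // u [|v s] IHs _; first by exists u => [|v]; rewrite inE // => ->.
have [//|w ws wmin] := IHs.
have [->|neq_uw] := eqVneq u w.
  exists w => [|v']; rewrite ?inE ?eqxx // => /predU1P[->|/wmin //].
  by rewrite eqxx.
have [lt_uw|] := boolP (lex_lt u w).
  exists u => [|v']; rewrite ?inE ?eqxx // => /predU1P[->|v's _].
    by rewrite eqxx.
  have [->//|neq_v'w] := eqVneq v' w.
  exact: lt_trans lt_uw (wmin _ v's neq_v'w).
rewrite /lex_lt -leNgt le_eqVlt => /predU1P[/eqP|lt_wu].
  by rewrite val_eqE eq_sym (negPf neq_uw).
exists w => [|v']; first by rewrite inE ws orbT.
by rewrite inE => /predU1P[->|/wmin].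
Qed.

End LexOrder.

(** * Monomial ideals as spans of sets of monomials *)

Section MonomialSpan.
Variables (K : fieldType) (n : nat).
Implicit Types (M : set 'X_{1..n}) (f g : {mpoly K[n]}) (m u v : 'X_{1..n}).

Definition mono_span M : set {mpoly K[n]} :=
  [set f | forall m, m \in msupp f -> M m].

Definition up_closed M := forall m m', M m -> M (m' + m)%MM.

Lemma mono_spanX M m : mono_span M 'X_[m] <-> M m.
Proof.
split=> [|Mm m']; first by apply; rewrite msuppX mem_head.
by rewrite msuppX inE => /eqP->.
Qed.

Lemma mono_span_ideal M : up_closed M -> is_ideal (mono_span M).
Proof.
move=> upM; split=> [m|f g Mf Mg m|a f Mf m]; first by rewrite msupp0.
  by move/msuppD_le; rewrite mem_cat => /orP[/Mf|/Mg].
by move/msuppM_le => /allpairsP[[m1 m2] [/= _ /Mf Mm2 ->]]; apply: upM.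
Qed.

Lemma mono_span_sub M (J : set {mpoly K[n]}) :
  is_ideal J -> (forall m, M m -> J 'X_[m]) -> mono_span M `<=` J.
Proof.
move=> idJ MJ f Mf; rewrite [f]mpolyE big_seq; apply: ideal_sum => // m /Mf/MJ.
by case: idJ => _ _ JM; rewrite -mul_mpolyC; apply: JM.
Qed.

Lemma mono_split M f :
  exists g h, [/\ f = g + h, mono_span M g & mono_span (~` M) h].
Proof.
exists (\sum_(m <- msupp f | `[<M m>]) f@_m *: 'X_[m]).
exists (\sum_(m <- msupp f | ~~ `[<M m>]) f@_m *: 'X_[m]).
split; first by rewrite [LHS]mpolyE (bigID (fun m => `[<M m>])).
  move=> m /msupp_sum_le/flatten_mapP[m']; rewrite mem_filter.
  by move=> /andP[/asboolP Mm' _] /msuppZ_le; rewrite msuppX inE => /eqP->.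
move=> m /msupp_sum_le/flatten_mapP[m']; rewrite mem_filter.
by move=> /andP[/asboolP Mm' _] /msuppZ_le; rewrite msuppX inE => /eqP->.
Qed.

(** The multiples of the generating monomials form M; membership in J is then tested on supports,
    monomial by monomial. *)
Lemma monomial_idealP (J : set {mpoly K[n]}) :
  monomial_ideal J <-> exists2 M, up_closed M & J = mono_span M.
Proof.
split=> [[A ->]|[M upM ->]].
  exists [set m | exists2 a, A a & (a <= m)%MM].
    move=> m m' [a Aa le_am]; exists a => //.
    by apply: lepm_trans le_am _; rewrite lem_addl.
  apply/seteqP; split; last first.
    apply: mono_span_sub; first exact: ideal_gen_is_ideal.
    move=> m [a Aa /submK <-]; rewrite mpolyXD.
    have [_ _ AM] := ideal_gen_is_ideal [set 'X_[K, m] | m in A].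
    by apply: AM; apply: sub_gen_smallest; exists a.
  apply: smallest_sub; first apply: mono_span_ideal.
    move=> m m' [a Aa le_am]; exists a => //.
    by apply: lepm_trans le_am _; rewrite lem_addl.
  by move=> _ [a Aa <-]; apply/mono_spanX; exists a => //; apply: lepm_refl.
exists M; apply/seteqP; split.
  apply: mono_span_sub; first exact: ideal_gen_is_ideal.
  by move=> m Mm; apply: sub_gen_smallest; exists m.
apply: smallest_sub; first exact: mono_span_ideal.
by move=> _ [m Mm <-]; apply/mono_spanX.
Qed.

(** Only the pair (u, v) contributes to the coefficient at u + v, which is thus a product of two
    nonzero scalars. *)
Lemma lex_min_mul f g u v :
  u \in msupp f -> (forall m, m \in msupp f -> m != u -> lex_lt u m) ->
  v \in msupp g -> (forall m, m \in msupp g -> m != v -> lex_lt v m) ->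
  (u + v)%MM \in msupp (f * g).
Proof.
move=> uf umin vg vmin.
(* [mcoeffM] sums over monomials of bounded degree; these bounds make (u, v) one of its indices. *)
have hu : (mdeg u < (mdeg (u + v)).+1)%N by rewrite mdegD ltnS leq_addr.
have hv : (mdeg v < (mdeg (u + v)).+1)%N by rewrite mdegD ltnS leq_addl.
rewrite mcoeff_msupp mcoeffM (bigD1 (BMultinom hu, BMultinom hv)) //=.
rewrite big1 ?addr0 ?mulf_neq0 -?mcoeff_msupp // => -[[a ha] [b hb]] /=.
move=> /andP[/eqP uvE neq].
have [af|/memN_msupp_eq0->] := boolP (a \in msupp f); last by rewrite mul0r.
have [bg|/memN_msupp_eq0->] := boolP (b \in msupp g); last by rewrite mulr0.
have [au|/(umin _ af) lt_ua] := eqVneq a u.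
  case/negP: neq; rewrite xpair_eqE -!val_eqE /= au eqxx /=.
  by move: uvE; rewrite au => /addmI->.
(* Any other pair in the supports has u < a and v <= b, so u + v < a + v <= a + b, against a + b = u
   + v. *)
suff: lex_lt (u + v)%MM (a + b)%MM by rewrite -uvE /lex_lt ltxx.
apply: (@lt_le_trans _ (n.-tuplelexi nat) (multinom_val (a + v)%MM)).
  by rewrite ![(_ + v)%MM]addmC; apply: lex_lt_add2l.
by have [->|/(vmin _ bg)/(lex_lt_add2l a)/ltW] := eqVneq b v.
Qed.

End MonomialSpan.

(** * Primes generated by initial variables, and localization at them *)

Section VariableIdeals.
Variables (K : fieldType) (n : nat).
Implicit Types (I J P : set {mpoly K[n]}) (f g : {mpoly K[n]}).
Implicit Types (m u v : 'X_{1..n}) (r : nat).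

Definition meets_vars r : set 'X_{1..n} :=
  [set m | exists2 i : 'I_n, (i < r)%N & (0 < m i)%N].

Local Notation var_ideal r := (@mono_span K n (meets_vars r)).

Lemma meets_vars_up r : up_closed (meets_vars r).
Proof.
by move=> m m' [i ir mi]; exists i; rewrite // mnmDE addn_gt0 mi orbT.
Qed.

Lemma meets_varsD r u v :
  meets_vars r (u + v)%MM -> meets_vars r u \/ meets_vars r v.
Proof.
move=> [i ir]; rewrite mnmDE addn_gt0 => /orP[]; [left|right]; by exists i.
Qed.

(** Let k be the first index where u and v differ. A variable of u with index i < r is shared with v
    if i < k; otherwise k <= i < r and v has a positive exponent at k. *)
Lemma meets_vars_lex r u v :
  lex_lt u v -> meets_vars r u -> meets_vars r v.
Proof.
move=> /lex_ltP[k eq_uv lt_uv] [i ir ui].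
have [ltik|leki] := ltnP i k; first by exists i; rewrite // -eq_uv.
by exists k; [apply: leq_ltn_trans ir | apply: leq_ltn_trans lt_uv].
Qed.

(* The variables generating the ideal are the lex-largest ones, so the        *)
(* lex-smallest monomial of f avoids them as soon as some monomial does.      *)
Lemma notin_var_ideal r f : ~ var_ideal r f ->
  exists u, [/\ u \in msupp f, ~ meets_vars r u
               & forall m, m \in msupp f -> m != u -> lex_lt u m].
Proof.
move=> Pf; have [|u uf umin] := @lex_min_exists n (msupp f).
  by apply: contra_notN Pf => /eqP f0 m; rewrite f0.
exists u; split=> // Mu; apply: Pf => m mf.
by have [->//|/(umin _ mf)/meets_vars_lex] := eqVneq m u; apply.
Qed.

(** The lex-smallest monomials of two elements outside avoid the first r variables, and so does
    their product, which occurs in f * g. *)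
Lemma var_ideal_prime r : prime_ideal (var_ideal r).
Proof.
split=> [||f g fg]; first exact/mono_span_ideal/meets_vars_up.
  by rewrite -mpolyX0 mono_spanX => -[i _]; rewrite mnmE.
apply: contrapT => /not_orP[/notin_var_ideal[u [uf Mu umin]]].
move=> /notin_var_ideal[v [vg Mv vmin]].
by have /fg/meets_varsD[] := lex_min_mul uf umin vg vmin.
Qed.

Lemma prime_idealX P m : prime_ideal P -> P 'X_[m] -> m != 0%MM.
Proof.
move=> [_ P1 _] Pm; apply: contra_notN P1 => /eqP m0.
by rewrite m0 mpolyX0 in Pm.
Qed.

Lemma prime_ideal_exp P f d : prime_ideal P -> P (f ^+ d) -> P f.
Proof.
move=> [_ P1 PM]; elim: d => [/P1//|d IHd].
by rewrite exprS => /PM[].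
Qed.

Lemma minimal_prime_lexsegment I P : lexsegment I -> minimal_primes I P ->
  exists r, P = var_ideal r.
Proof.
move=> [/monomial_idealP[M upM IM] lexI] [prP IP minP].
have [[_ _ PM] _ _] := prP.
(* All n variables suffice: the only monomial avoiding them is 1, which is not in I since I lies in
   the proper ideal P. *)
have ex_r : exists r, `[<I `<=` var_ideal r>].
  exists n; apply/asboolP; rewrite IM => f Mf m /Mf Mm.
  have /IP/(prime_idealX prP) : I 'X_[m] by rewrite IM mono_spanX.
  apply: contra_neqP => Nm; apply/mnmP => i; rewrite mnmE.
  by apply/eqP; apply: contra_notT Nm; rewrite -lt0n => mi; exists i.
case: (ex_minnP ex_r) => r /asboolP Ir rmin; exists r; apply/esym.
apply: minP => //; first exact: var_ideal_prime.
apply: mono_span_sub; first by case: prP.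
move=> m [j jr mj].
(* The least bound is now r.+1, so by minimality some monomial m' of I avoids the variables of index
   below r. *)
case: r => // r in Ir rmin jr *.
have [m' [Mm' Nm']] : exists m', M m' /\ ~ meets_vars r m'.
  apply: contrapT => Nex; have: (r < r)%N; last by rewrite ltnn.
  apply: rmin; apply/asboolP; rewrite IM => f Mf u /Mf Mu.
  by apply: contrapT => Nu; apply: Nex; exists u.
have Im' : I 'X_[m'] by rewrite IM mono_spanX.
(* As j <= r, the power of x_j of the same degree as m' is either m' itself or lex-larger, hence
   lies in I and so in P. *)
have Pj : P 'X_j.
  apply: (@prime_ideal_exp _ _ (mdeg m')) => //; rewrite mpolyXn; apply: IP.
  have Nm'0 (i : 'I_n) : (i < r)%N -> m' i = 0%N.
    by move=> ir; apply/eqP; apply: contra_notT Nm'; rewrite -lt0n; exists i.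
  have [m'E|ne_m'] := eqVneq m' (U_(j) *+ mdeg m')%MM; first by rewrite -m'E.
  apply: lexI Im' _ _; first by rewrite mdegMn mdeg1 mul1n.
  apply/lex_ltP; exists j => [i ij|].
    rewrite Nm'0; last exact: leq_trans ij _.
    by rewrite mulmnE mnm1E -val_eqE /= (gtn_eqF ij).
  (* Otherwise this power of x_j divides m', and equality of degrees makes them equal. *)
  rewrite mulmnE mnm1E eqxx mul1n ltnNge; apply: contra ne_m' => le_m'j.
  have /submK m'E : (U_(j) *+ mdeg m' <= m')%MM.
    apply/mnm_lepP => i; rewrite mulmnE mnm1E.
    by have [<-|_] := eqVneq j i; rewrite ?mul1n ?mul0n.
  move: (congr1 (@mdeg n) m'E); rewrite mdegD mdegMn mdeg1 mul1n => /eqP.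
  rewrite -[X in _ == X]add0n eqn_add2r mdeg_eq0 => /eqP m'0.
  by rewrite -[X in X == _]m'E m'0 add0m.
have /submK <- : (U_(j) <= m)%MM.
  by apply/mnm_lepP => i; rewrite mnm1E; case: eqVneq => // <-.
by rewrite mpolyXD; case: (prP) => -[_ _ JM] _ _; apply: JM.
Qed.

Lemma loc_ker_var_ideal J r : monomial_ideal J ->
  loc_ker J (var_ideal r) =
  mono_span [set m | exists2 t, ~ meets_vars r t & J 'X_[t + m]].
Proof.
case/monomial_idealP=> M upM ->; have idJ := mono_span_ideal K upM.
have prP := var_ideal_prime r; have idker := loc_ker_is_ideal idJ prP.
set N := [set m | _].
have kerN : mono_span N `<=` loc_ker (mono_span M) (var_ideal r).
  apply: mono_span_sub => // m [t Mt Jtm]; apply/loc_kerP => //.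
  by exists 'X_[t]; rewrite ?mono_spanX // -mpolyXD.
apply/seteqP; split=> // f kerf.
(* Discarding the part of f supported on N leaves h in the kernel with no monomial in N. If h were
   nonzero, its lex-smallest monomial v, multiplied by that of s, would occur in s * h, putting v in
   N. *)
have [g [h [fE Ng Nh]]] := mono_split N f.
suff h0 : h = 0 by rewrite fE h0 addr0.
have : loc_ker (mono_span M) (var_ideal r) h.
  by rewrite -(addKr g h) -fE addrC; apply: idealB => //; apply: kerN.
case/loc_kerP=> // s /notin_var_ideal[u [us Mu umin]] Msh.
apply/eqP; rewrite -msupp_eq0; apply/negP => /negP/lex_min_exists[v vh vmin].
apply: (Nh _ vh); exists u => //; apply/mono_spanX/Msh.
exact: lex_min_mul vmin.
Qed.

(** The multiplier t that works for u also works for v: translation by t preserves both equality of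
    degrees and the lex order. *)
Lemma lexsegment_loc_ker J r : lexsegment J ->
  lexsegment (loc_ker J (var_ideal r)).
Proof.
move=> [monJ lexJ]; have [M upM JM] := (monomial_idealP J).1 monJ.
rewrite loc_ker_var_ideal //; split.
  apply/monomial_idealP; eexists; last by [].
  move=> m m' [t Mt Jtm]; exists t => //.
  rewrite addmA (addmC t) -addmA JM mono_spanX; apply: upM.
  by rewrite -(mono_spanX K) -JM.
move=> u v; rewrite !mono_spanX => -[t Mt Jtu] deg_vu lt_uv; exists t => //.
by apply: lexJ Jtu _ _; [rewrite !mdegD deg_vu | apply: lex_lt_add2l].
Qed.

(** An intersection of monomial spans is the span of the common monomials. An empty D gives the
    whole ring, as happens when I is the unit ideal and has no minimal primes. *)
Lemma lexsegment_bigcap (T : Type) (D : set T) (F : T -> set {mpoly K[n]}) :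
  (forall i, D i -> lexsegment (F i)) -> lexsegment (\bigcap_(i in D) F i).
Proof.
move=> lexF; split; last first.
  move=> u v Fu deg_vu lt_uv i Di; have [_ lexFi] := lexF i Di.
  exact: lexFi (Fu i Di) deg_vu lt_uv.
apply/monomial_idealP; exists [set m | forall i, D i -> F i 'X_[m]].
  move=> m m' Fm i Di; have [/monomial_idealP[M upM FM] _] := lexF i Di.
  move: (Fm i Di); rewrite FM mpolyXD.
  by case: (mono_span_ideal K upM) => _ _; apply.
apply/seteqP; split=> f Ff.
  move=> m mf i Di; have [/monomial_idealP[M upM FM] _] := lexF i Di.
  by rewrite FM mono_spanX; move: (Ff i Di); rewrite FM; apply.
move=> i Di; have [/monomial_idealP[M upM FM] _] := lexF i Di.
by rewrite FM => m /Ff/(_ i Di); rewrite FM mono_spanX.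
Qed.

End VariableIdeals.

Theorem proposition3p12 (K : fieldType) (n : nat) (I : set {mpoly K[n]})
    (infK : infinite_set [set: K]) (stableI : stably_lexsegment I)
    (k : nat) (k_gt0 : (0 < k)%N) :
  lexsegment (symbolic_power I k).
Proof.
case: stableI => -[A IA] lexIk.
have idI : is_ideal I by rewrite IA; apply: ideal_gen_is_ideal.
have lexI : lexsegment I by rewrite -(ideal_pow1 idI); apply: lexIk.
apply: lexsegment_bigcap => P /(minimal_prime_lexsegment lexI)[r ->].
exact/lexsegment_loc_ker/lexIk.
Qed.
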